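(* Let $k\ge 0$ be an integer and let $G$ be a graph of order $n=4k+1$ with Seidel matrix $S$. Then $S$ is singular and $\phi(S)\in\{\pm 1\}^n$ if and only if $G$ belongs to the switching class of a $2k$-regular graph.
   Context: All graphs are simple, undirected, finite, with at least one vertex. The order of a graph is its number of vertices. For a graph $G$ with vertices $v_1,\dots,v_n$ and adjacency matrix $A$, the Seidel matrix of $G$ is $S=J_n-I_n-2A$, where $J_n$ is the all-ones $n\times n$ matrix and $I_n$ the identity. It is known that $\operatorname{rank} S\ge n-1$ always. Hence, when $S$ is singular, its nullspace is one-dimensional, and $\phi(S)$ denotes the unique integer vector $\phi\in\mathbb{Z}^n$ with $S\phi=0$, with the greatest common divisor of its entries equal to $1$, and with first non-zero entry positive. Switching a graph with respect to a vertex $v$ means deleting all edges between $v$ and its neighbors and making $v$ adjacent to all its former non-neighbors (other than $v$ itself). Two graphs on the same vertex set are switching-equivalent if one can be obtained from the other by a sequence of switchings; equivalently, if one is obtained from the other by choosing a vertex subset $A$ and complementing the edges and non-edges between $A$ and its complement. The switching class of a graph is its equivalence class under this relation. *)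

(* Defs.v *)
From mathcomp Require Import all_boot all_order all_algebra.

Set Implicit Arguments.
Unset Strict Implicit.
Unset Printing Implicit Defensive.

Import Order.TTheory GRing.Theory Num.Theory.
Local Open Scope ring_scope.

Definition simple_graph n (e : rel 'I_n) : Prop := symmetric e /\ irreflexive e.

Definition regular n (d : nat) (e : rel 'I_n) : Prop :=
  forall x, #|[set y | e x y]| = d.

Definition adjacency n (e : rel 'I_n) : 'M[int]_n := \matrix_(i, j) (e i j)%:R.

Definition seidel n (e : rel 'I_n) : 'M[int]_n :=
  const_mx 1 - 1%:M - adjacency e *+ 2.

Definition switch n (e : rel 'I_n) (v : 'I_n) : rel 'I_n :=
  fun x y => if (x == v) (+) (y == v) then ~~ e x y else e x y.

Definition switching_equivalent n (e e' : rel 'I_n) : Prop :=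
  exists s : seq 'I_n, foldl (@switch n) e s =2 e'.

(* [is_phi S x] says that x is the vector denoted by phi(S); for a singular
   Seidel matrix there is exactly one such x, see [seidel_phi_unique]. *)
Record is_phi n (S : 'M[int]_n) (x : 'cV[int]_n) : Prop := IsPhi {
  phi_ker : S *m x = 0;
  phi_gcd : \big[gcdn/0%N]_i absz (x i ord0) = 1%N;
  phi_pos : forall i, x i 0 != 0 ->
    (forall j : 'I_n, (j < i)%N -> x j 0 = 0) -> 0 < x i 0
}.

Lemma seidel_mulE n (e : rel 'I_n) (x : 'cV[int]_n) i :
  (seidel e *m x) i 0 = \sum_j x j 0 - x i 0 - (\sum_(j | e i j) x j 0) *+ 2.
Proof.
rewrite /seidel !mulmxBl mul1mx !mxE; congr (_ - _ - _).
  by apply: eq_bigr => j _; rewrite mxE mul1r.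
rewrite -sumrMnl [RHS]big_mkcond /=; apply: eq_bigr => j _.
by rewrite mulr2n !mxE; case: (e i j) => /=; rewrite ?mulrDl ?mul1r ?mul0r ?addr0.
Qed.

Lemma zscale_eq0 n (c : int) (x : 'cV[int]_n) : c != 0 -> c *: x = 0 -> x = 0.
Proof.
move=> c0 /colP cx; apply/colP => i; have /eqP := cx i.
by rewrite !mxE mulf_eq0 (negPf c0) => /eqP.
Qed.

Lemma primitive_part n (x : 'cV[int]_n) : x != 0 ->
  exists (g : nat) (y : 'cV[int]_n),
    [/\ (0 < g)%N, x = g%:Z *: y & \big[gcdn/0%N]_i absz (y i ord0) = 1%N].
Proof.
move=> x0; pose g := \big[gcdn/0%N]_i absz (x i ord0).
have gd i : (g %| absz (x i ord0))%N by apply: (biggcdn_inf i).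
have g0 : (0 < g)%N.
  rewrite lt0n; apply: contra_neq x0 => gE; apply/colP => i.
  by move: (gd i); rewrite gE dvd0n mxE absz_eq0 => /eqP.
pose y : 'cV[int]_n := \col_i (x i ord0 %/ g%:Z)%Z.
have xE : x = g%:Z *: y.
  by apply/colP => i; rewrite !mxE mulrC divzK // dvdzE /= gd.
exists g, y; split=> //; set h := \big[gcdn/0%N]_i _.
have : (g * h %| g)%N.
  rewrite {2}/g; apply/dvdn_biggcdP => i _.
  by rewrite xE mxE abszM dvdn_mul // /h; apply: (biggcdn_inf i).
by rewrite -{2}[g]muln1 dvdn_pmul2l // dvdn1 => /eqP.
Qed.

Lemma seidel_ker_odd n (e : rel 'I_n) (x : 'cV[int]_n) :
  seidel e *m x = 0 -> \big[gcdn/0%N]_i absz (x i ord0) = 1%N ->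
  forall i, ~~ (2 %| x i ord0)%Z.
Proof.
move=> Sx gx i; apply/negP => xi.
have par j : (2 %| \sum_k x k ord0 - x j ord0)%Z.
  have /colP/(_ j) := Sx; rewrite seidel_mulE mxE => /eqP.
  by rewrite subr_eq0 => /eqP->; rewrite -(mulr_natr (\sum_(_ <- _ | _) _)); apply: dvdz_mull.
have sx : (2 %| \sum_k x k ord0)%Z.
  by rewrite -(subrK (x i ord0) (\sum_k _)) rpredD.
suff : (2 %| \big[gcdn/0%N]_i absz (x i ord0))%N by rewrite gx.
apply/dvdn_biggcdP => j _.
suff : (2 %| x j ord0)%Z by rewrite dvdzE.
by rewrite -[x j ord0](subKr (\sum_k x k ord0)) rpredB.
Qed.

Lemma seidel_phi_unique n (e : rel 'I_n) : \det (seidel e) = 0 ->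
  exists! x, is_phi (seidel e) x.
Proof.
move=> d0.
have [v v0 vS] : exists2 v : 'rV[int]_n, v != 0 & v *m (seidel e)^T = 0.
  by apply/det0P; rewrite det_tr d0.
have vT0 : v^T != 0 by apply: contra_neq v0 => /(congr1 trmx); rewrite trmxK trmx0.
have Sv : seidel e *m v^T = 0 by apply: trmx_inj; rewrite trmx_mul trmxK vS trmx0.
have [g [y [g0 vE gy]]] := primitive_part vT0.
have Sy : seidel e *m y = 0.
  by move: Sv; rewrite vE -scalemxAr; apply: zscale_eq0; rewrite eqz_nat -lt0n.
have n0 : (0 < n)%N.
  by case: n y gy {e d0 v v0 vS vT0 Sv vE Sy} => // y; rewrite big_ord0.
pose o := Ordinal n0.
have nz (x : 'cV[int]_n) : seidel e *m x = 0 ->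
    \big[gcdn/0%N]_i absz (x i ord0) = 1%N -> forall i, x i ord0 != 0.
  by move=> Sx gx i; have := seidel_ker_odd Sx gx i; apply: contraNneq => ->.
pose x := Num.sg (y o ord0) *: y.
have sg1 : absz (Num.sg (y o ord0)) = 1%N by rewrite absz_sg nz.
have phix : is_phi (seidel e) x.
  have Sx : seidel e *m x = 0 by rewrite -scalemxAr Sy scaler0.
  have gx : \big[gcdn/0%N]_i absz (x i ord0) = 1%N.
    by rewrite -[RHS]gy; apply: eq_bigr => i _; rewrite mxE abszM sg1 mul1n.
  split=> // i _ xi; case: (posnP i) => [i0|/(xi o)/eqP]; last first.
    by rewrite (negPf (nz _ Sx gx o)).
  have -> : i = o by apply: val_inj.
  by rewrite mxE -normrEsg normr_gt0 nz.
have pos z : is_phi (seidel e) z -> 0 < z o ord0.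
  by case=> Sz gz; apply=> //; apply: nz.
clearbody x; exists x; split=> // z phiz.
have [Sx gx _] := phix; have [Sz gz _] := phiz.
have xz : z o ord0 *: x = x o ord0 *: z.
  apply/eqP; rewrite -subr_eq0; apply/negPn/negP => w0.
  have [h [w [h0 wE gw]]] := primitive_part w0.
  have Sw : seidel e *m w = 0.
    have : seidel e *m (h%:Z *: w) = 0.
      by rewrite -wE mulmxBr -!scalemxAr Sx Sz !scaler0 subr0.
    by rewrite -scalemxAr; apply: zscale_eq0; rewrite eqz_nat -lt0n.
  have /eqP := congr1 (fun m : 'cV[int]_n => m o ord0) wE.
  rewrite !mxE mulrC subrr eq_sym mulf_eq0 (negPf (nz _ Sw gw o)) orbF.
  by rewrite eqz_nat gtn_eqF.
have dv (a b : 'cV[int]_n) : \big[gcdn/0%N]_i absz (a i ord0) = 1%N ->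
    b o ord0 *: a = a o ord0 *: b -> (absz (a o ord0) %| absz (b o ord0))%N.
  move=> ga ab; have -> : absz (b o ord0) =
      \big[gcdn/0%N]_i absz (b o ord0 * a i ord0).
    under eq_bigr do rewrite abszM.
    rewrite -[LHS]muln1 -[X in (_ * X)%N = _]ga; apply: (big_morph (muln _)) => [p q|].
      by rewrite muln_gcdr.
    by rewrite muln0.
  apply/dvdn_biggcdP => i _.
  have /colP/(_ i) := ab; rewrite !mxE => ->.
  by rewrite abszM dvdn_mulr.
have xzo : x o ord0 = z o ord0.
  have /eqP : absz (x o ord0) = absz (z o ord0).
    by apply/eqP; rewrite eqn_dvd !dv.
  by rewrite -eqz_nat !gez0_abs ?ltW ?pos // => /eqP.
apply/subr0_eq/(@zscale_eq0 _ (z o ord0)); first by rewrite gt_eqF ?pos.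
by rewrite scalerBr xz xzo subrr.
Qed.

(* Main.v *)
(* Switching on a vertex set conjugates the Seidel matrix by the diagonal matrix
   of the corresponding signs, so sign vectors in the kernel of S(G) correspond
   to graphs in the switching class whose Seidel matrix kills the all-ones
   vector; the i-th row sum of a Seidel matrix is n - 1 - 2 deg(i), which
   vanishes for all i exactly when the graph is (n - 1)/2-regular. *)
Require Import Defs.
From mathcomp Require Import all_boot all_order all_algebra.
From mathcomp Require Import zify.
Import GRing.Theory Num.Theory.
Local Open Scope ring_scope.

(** Switching at [v] flips the pair [x], [y] exactly when one of the two is [v], so only the
    parities of the occurrences in [s] matter. *)
Lemma foldl_switchE n (e : rel 'I_n) (s : seq 'I_n) x y :
  foldl (@switch n) e s x y =
  e x y (+) (odd (count_mem x s) (+) odd (count_mem y s)).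
Proof.
elim: s e => [|v s IHs] e; first by rewrite addbF.
rewrite /= IHs /switch !oddD (eq_sym v x) (eq_sym v y).
by case: (x == v); case: (y == v); case: (e x y); do 2?case: (odd _).
Qed.

(** This multiplicative form turns xor of adjacencies into a product of signs. *)
Lemma seidelE {n} {e : rel 'I_n} i j : irreflexive e ->
  seidel e i j = (i != j)%:R * (-1) ^+ e i j.
Proof.
by move=> e_irr; rewrite !mxE; case: eqVneq => [->|_];
  rewrite ?e_irr ?mul0r ?mul1r ?mulr0n ?subrr ?subr0 //; case: (e i j).
Qed.

(** In each term of row [i], the sign of [b j] coming from the matrix cancels the one in the vector,
    leaving the common factor [(-1) ^+ b i]. *)
Lemma seidel_cut_mul_sign {n} {e e' : rel 'I_n} {b : 'I_n -> bool} :
    irreflexive e -> (forall x y, e' x y = e x y (+) (b x (+) b y)) ->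
  forall i, (seidel e' *m \col_j (-1) ^+ b j : 'cV_n) i 0 =
            (-1) ^+ b i * (seidel e *m const_mx 1 : 'cV_n) i 0.
Proof.
move=> e_irr e'E i.
have e'_irr : irreflexive e' by move=> x; rewrite e'E e_irr addbb.
rewrite mxE [in RHS]mxE big_distrr /=; apply: eq_bigr => j _.
rewrite (seidelE _ _ e_irr) (seidelE _ _ e'_irr) !mxE e'E.
by case: (i != j); case: (e i j); case: (b i); case: (b j).
Qed.

Lemma regular_seidel_ones {n d} (e : rel 'I_n) : n = (2 * d + 1)%N ->
  regular d e <-> seidel e *m const_mx 1 = 0 :> 'cV_n.
Proof.
move=> nE.
have rowE i : (seidel e *m const_mx 1 : 'cV_n) i 0 =
    n%:Z - 1 - #|[set y | e i y]|%:Z *+ 2.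
  rewrite seidel_mulE mxE; congr (_ - _ - _ *+ 2).
    by under eq_bigr do rewrite mxE; rewrite sumr_const card_ord natz.
  under eq_bigr do rewrite mxE.
  by rewrite sumr_const natz; congr (Posz _); apply: eq_card => y; rewrite inE.
split=> [reg | /colP e0 x].
  by apply/colP => i; rewrite rowE reg mxE; lia.
by move: (e0 x); rewrite rowE mxE; lia.
Qed.

Theorem theorem5p1 (k n : nat) (hn : n = (4 * k + 1)%N)
    (G : rel 'I_n) (hG : simple_graph G) :
  (\det (seidel G) = 0 /\
     exists2 phi : 'cV[int]_n, is_phi (seidel G) phi &
       forall i : 'I_n, phi i ord0 = 1 \/ phi i ord0 = -1)
  <->
  (exists H : rel 'I_n,
     [/\ simple_graph H, regular (2 * k)%N H & switching_equivalent H G]).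
Proof.
have nE : n = (2 * (2 * k) + 1)%N by lia.
have [G_sym _] := hG.
split=> [[_ [phi [Gphi _ _] phi1]] | [H [[_ H_irr] H_reg [s sE]]]].
  pose b i := phi i ord0 == -1.
  have phiE : phi = \col_j (-1) ^+ b j.
    by apply/colP => i; rewrite mxE /b; case: (phi1 i) => ->.
  pose H : rel 'I_n := fun x y => G x y (+) (b x (+) b y).
  have H_irr : irreflexive H by move=> x; rewrite /H addbb addbF; case: hG.
  have GE x y : G x y = H x y (+) (b x (+) b y) by rewrite /H addbK.
  exists H; split.
  - by split=> // x y; rewrite /H G_sym (addbC (b x)).
  - apply/(regular_seidel_ones H nE)/colP => i.
    have := seidel_cut_mul_sign H_irr GE i.
    rewrite -phiE Gphi [LHS]mxE => /esym/eqP.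
    by rewrite mulf_eq0 signr_eq0 => /eqP ->; rewrite mxE.
  (* [enum b] lists each vertex at most once, so the parity of a count is membership in [b]. *)
  exists (enum b) => x y; rewrite foldl_switchE GE.
  by rewrite !count_uniq_mem ?enum_uniq // !mem_enum !oddb.
have n_gt0 : (0 < n)%N by lia.
pose o := Ordinal n_gt0.
(* Adding the parity at [o] normalises the first entry of [phi] to 1, as [phi_pos] demands; being
   constant, it cancels in [b x (+) b y]. *)
pose b i := odd (count_mem i s) (+) odd (count_mem o s).
have GE x y : G x y = H x y (+) (b x (+) b y).
  by rewrite -sE foldl_switchE /b addbACA addbb addbF.
pose phi : 'cV[int]_n := \col_j (-1) ^+ b j.
have Gphi : seidel G *m phi = 0.
  apply/colP => i; rewrite (seidel_cut_mul_sign H_irr GE).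
  by move/(regular_seidel_ones H nE): H_reg => ->; rewrite !mxE mulr0.
have phi_o : phi o ord0 = 1 by rewrite mxE /b addbb.
split.
  rewrite -det_tr; apply/eqP/det0P; exists phi^T.
    by apply/eqP => /matrixP/(_ ord0 o)/eqP; rewrite mxE phi_o mxE oner_eq0.
  by rewrite -trmx_mul Gphi trmx0.
exists phi => [|i]; last by rewrite mxE; case: (b i); [right | left].
split=> // [|i _ phi_lt].
  by apply/eqP; rewrite -dvdn1 (biggcdn_inf o) // phi_o.
(* An index [i > 0] would force the entry at [o] to vanish, but it is 1. *)
case: (posnP i) => [i0|/(phi_lt o)/eqP]; last by rewrite phi_o oner_eq0.
by have -> : i = o by [apply: val_inj]; rewrite phi_o.
Qed.
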